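(* For every integer $m\ge 3$, every randomized algorithm for the online multiprocessor scheduling with testing problem on $m$ machines has expected competitive ratio at least $\frac{21}{2}-\sqrt{78}\approx 1.6682$.
   Context: Online multiprocessor scheduling with testing ($P\mid online, t_j, 0\le p_j\le u_j\mid C_{\max}$) on $m$ identical parallel machines: jobs $J_1,\dots,J_n$ arrive one by one in this order. When $J_j$ arrives, an upper bound $u_j\ge0$ and a testing time $t_j\ge0$ are revealed; its processing time $p_j\in[0,u_j]$ is unknown. Upon arrival the algorithm must irrevocably decide whether to test $J_j$ and on which machine to process it. An untested job occupies its machine for $u_j$ time; a tested job for $t_j+p_j$ time, $p_j$ being revealed after testing. The makespan is the maximum machine load. With $\rho_j=\min\{u_j,t_j+p_j\}$, the optimal offline makespan $C^*(I)$ is the minimum over assignments of jobs to machines of the maximum over machines of the sum of $\rho_j$ of the jobs assigned to it. A randomized algorithm is a probability distribution over deterministic online algorithms; its expected competitive ratio is $\sup_I E[C(I)]/C^*(I)$ over all instances $I$. *)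

(* Defs.v *)
From HB Require Import structures.
From mathcomp Require Import all_boot all_order all_algebra.
From mathcomp Require Import all_classical all_reals all_analysis.

Set Implicit Arguments.
Unset Strict Implicit.
Unset Printing Implicit Defensive.

Import Order.TTheory GRing.Theory Num.Theory.

Local Open Scope classical_set_scope.
Local Open Scope ring_scope.

(* The upper bound is nonnegative as a consequence of the last two fields. *)
Record job (R : realType) := Job {
  ubound : R;
  ttime : R;
  ptime : R;
  ttime_ge0 : 0 <= ttime;
  ptime_ge0 : 0 <= ptime;
  ptime_le : ptime <= ubound }.

(* The jobs, in order of arrival. *)
Definition instance (R : realType) := seq (job R).

(* What is known about an earlier job; seen_ptime is None when the job was
   executed untested. *)
Record past_job (R : realType) := PastJob {
  seen_ubound : R;
  seen_ttime : R;
  seen_ptime : option R }.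

Record decision (m : nat) := Decision {
  tested : bool;
  machine : 'I_m }.

(* A h u t is the decision for a newly arrived job with upper bound u and
   testing time t, after the past jobs h (in order of arrival). The algorithm
   knows neither the number of jobs still to come nor the processing time of the
   new job. Its own earlier machine choices need not be recorded in h: they are
   determined by A and the proper prefixes of h. *)
Definition online_algorithm (R : realType) (m : nat) :=
  seq (past_job R) -> R -> R -> decision m.

(* A schedule lists, for each job, its machine and the time it occupies there. *)
Definition makespan (R : realType) (m : nat) (S : seq ('I_m * R)) : R :=
  \big[Num.max/0]_(i < m) \sum_(x <- S | x.1 == i) x.2.

Fixpoint schedule_from (R : realType) (m : nat) (A : online_algorithm R m)
    (h : seq (past_job R)) (I : instance R) : seq ('I_m * R) :=
  if I is j :: I' then
    let d := A h (ubound j) (ttime j) in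
    let len := if tested d then ttime j + ptime j else ubound j in
    let obs := PastJob (ubound j) (ttime j)
                 (if tested d then Some (ptime j) else None) in
    (machine d, len) :: schedule_from A (rcons h obs) I'
  else [::].

Definition alg_makespan (R : realType) (m : nat) (A : online_algorithm R m)
    (I : instance R) : R :=
  makespan (schedule_from A [::] I).

Definition offline_time (R : realType) (j : job R) : R :=
  Num.min (ubound j) (ttime j + ptime j).

(* For m > 0 this is the infimum of a finite nonempty set, hence a minimum. *)
Definition opt_makespan (R : realType) (m : nat) (I : instance R) : R :=
  inf [set makespan (zip a (map (@offline_time R) I))
      | a in [set: (size I).-tuple 'I_m]].

(* A random deterministic algorithm on an arbitrary probability space. The only
   measurability required is what gives each expected makespan a meaning. *)
Record randomized_algorithm (R : realType) (m : nat) := RandomizedAlgorithm {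
  ra_display : measure_display;
  ra_space : measurableType ra_display;
  ra_prob : probability ra_space R;
  ra_alg : ra_space -> online_algorithm R m;
  ra_measurable : forall I : instance R,
    measurable_fun [set: ra_space] (fun w => alg_makespan (ra_alg w) I) }.

Definition expected_makespan (R : realType) (m : nat)
    (A : randomized_algorithm R m) (I : instance R) : \bar R :=
  expectation (ra_prob A) (fun w => alg_makespan (ra_alg w) I).

(* In \bar R the inverse of 0 is +oo and 0 * +oo = 0: an instance with optimal
   makespan 0 contributes 0 if the expected makespan is also 0, and +oo
   otherwise. *)
Definition expected_competitive_ratio (R : realType) (m : nat)
    (A : randomized_algorithm R m) : \bar R :=
  ereal_sup [set (expected_makespan A I / (opt_makespan m I)%:E)%E
            | I in [set: instance R]].

(* Main.v *)
Require Import Defs.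
From mathcomp Require Import all_boot all_order all_algebra.
From mathcomp Require Import all_classical all_reals all_analysis.
From mathcomp Require Import measurable_realfun ring lra.
Import Order.TTheory GRing.Theory Num.Theory.
Local Open Scope ring_scope.

(* Every job of the adversary has testing time [t] and upper bound [2 t], and its
   processing time is [0] or [2 t] with probability 1/2 each. Whatever the algorithm
   decides, it spends [2 t] on average, against [3/2 t] offline, so its expected total
   load is [4/3] of the expected total offline time. [40 m] jobs with [t = 1] are
   followed by [m] big jobs with [t = S / (2 (m - 1))], where [S] is the total offline
   time so far; the input stops after the [k]-th big job, [k] uniform in [1, m].

   Removing the last job changes the load of one machine only, so the makespans
   without the last [0, 1, ..., m - 1] jobs dominate the final loads in decreasing
   order: the [m] makespans add up to at least the total load (an idea of Sgall).
   Offline, the big jobs never exceed the average load, and the small jobs fill the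
   gaps, so the optimum is within [2] of the average load.

   The total grows by a mean factor [g = 1 + 3 / (4 (m - 1))] per big job, hence the
   ratio is about [4/3 m g^m / (g + ... + g^m)], which is at least [7/4] for [m >= 3];
   the bound [1.67 > 21/2 - sqrt 78] leaves room for the additive error [2]. *)

(** * Machine loads, prefixes of a schedule, and greedy assignments *)

Section Makespan.
Context {R : realType} {m : nat}.
Implicit Types (s : seq ('I_m * R)) (i : 'I_m).

Definition load s i : R := \sum_(x <- s | x.1 == i) x.2.

Lemma load_cons (x : 'I_m * R) s i :
  load (x :: s) i = (if x.1 == i then x.2 else 0) + load s i.
Proof. by rewrite /load big_cons; case: ifP; rewrite ?add0r. Qed.

Lemma load_rcons s (x : 'I_m * R) i :
  load (rcons s x) i = load s i + (if x.1 == i then x.2 else 0).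
Proof.
by rewrite /load -cats1 big_cat big_cons big_nil /=; case: ifP; rewrite ?addr0.
Qed.

Lemma sum_load s : \sum_i load s i = \sum_(x <- s) x.2.
Proof.
rewrite /load (exchange_big_dep predT) //=.
by apply: eq_bigr => x _; rewrite (big_pred1 x.1) // => i; rewrite eq_sym.
Qed.

Lemma load_le_makespan s i : load s i <= makespan s.
Proof. exact: le_bigmax. Qed.

Lemma makespan_le s (L : R) : 0 <= L -> (forall i, load s i <= L) -> makespan s <= L.
Proof. by move=> L0 H; apply: bigmax_le => // i _; apply: H. Qed.

Lemma makespan_ge0 s : 0 <= makespan s.
Proof. exact: bigmax_ge_id. Qed.

(** Peel off the last job: it affects one machine, whose load is charged to the current makespan,
    and the other machines of [B] keep their loads without it. Once the jobs run out, the prefixes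
    are empty. *)
Lemma sum_load_le_prefixes (k : nat) (B : {set 'I_m}) s : (#|B| <= k)%N ->
  \sum_(i in B) load s i <= \sum_(l < k) makespan (take (size s - l) s).
Proof.
elim: k B s => [|k IH] B s.
  by rewrite leqn0 cards_eq0 => /eqP->; rewrite big_set0 big_ord0.
have [->|[i0 i0B]] := set_0Vmem B.
  by move=> _; rewrite big_set0; apply: sumr_ge0 => *; apply: makespan_ge0.
move=> cardB; rewrite big_ord_recl subn0 take_size.
case/lastP: s => [|s x].
  rewrite big1; last by move=> i _; rewrite /load big_nil.
  by rewrite addr_ge0 ?makespan_ge0 ?sumr_ge0 // => *; apply: makespan_ge0.
(* If the last job misses [B], any machine of [B] can be charged. *)
pose j := if x.1 \in B then x.1 else i0.
have jB : j \in B by rewrite /j; case: ifP.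
rewrite (big_setD1 j) //= lerD ?load_le_makespan //.
have cardBj : (#|B :\ j| <= k)%N by rewrite -ltnS -[k.+1]add1n -ltnS (cardsD1 j) jB add1n in cardB *.
have -> : \sum_(i in B :\ j) load (rcons s x) i = \sum_(i in B :\ j) load s i.
  apply: eq_bigr => i; rewrite !inE => /andP[ij iB].
  rewrite load_rcons; case: eqP => [xi|]; last by rewrite addr0.
  by move: ij; rewrite /j xi iB eqxx.
apply: le_trans (IH _ s cardBj) _.
rewrite le_eqVlt; apply/orP; left; apply/eqP; apply: eq_bigr => l _.
rewrite size_rcons /bump /= add1n subSS -cats1 takel_cat //.
exact: leq_subr.
Qed.

Lemma total_load_le_prefixes s :
  \sum_(x <- s) x.2 <= \sum_(k < m) makespan (take (size s - k) s).
Proof.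
rewrite -sum_load.
have := @sum_load_le_prefixes m [set: 'I_m] s.
rewrite cardsT card_ord leqnn => /(_ isT).
by under eq_bigl do rewrite inE.
Qed.

Lemma separate_assignment (r : seq R) (L : R) : 0 <= L ->
  (size r <= m)%N -> all (<= L) r ->
  exists2 a : seq 'I_m, size a = size r & forall i, load (zip a r) i <= L.
Proof.
move=> L0 rm rL.
(* Strengthened for the induction: machines from index [size r] on are empty, so machine [size r]
   can take the next job. *)
suff [a [sa _ la]] : exists a : seq 'I_m,
    [/\ size a = size r, forall i, (size r <= i)%N -> load (zip a r) i = 0
      & forall i, load (zip a r) i <= L] by exists a.
elim/last_ind: r rm rL => [|r x IH].
  by move=> _ _; exists [::]; split => // i *; rewrite /load big_nil.
rewrite size_rcons all_rcons => rm /andP[xL rL].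
have [a [sa a0 la]] := IH (ltnW rm) rL.
exists (rcons a (Ordinal rm)); rewrite zip_rcons // size_rcons; split; first by rewrite sa.
- move=> i ri; rewrite load_rcons (a0 _ (ltnW ri)) add0r.
  by case: eqP => // xi; move: ri; rewrite -xi /= ltnn.
- move=> i; rewrite load_rcons; case: eqP => [<-|_] /=; last by rewrite addr0.
  by rewrite a0 ?add0r.
Qed.

(** The big jobs get separate machines; then each small job, from the last to the first, joins a
    machine of load at most [L], which exists by averaging. *)
Lemma greedy_assignment (small big : seq R) (L e : R) : (0 < m)%N -> 0 <= L -> 0 <= e ->
  all (fun x => 0 <= x <= e) small -> (size big <= m)%N -> all (<= L) big ->
  \sum_(x <- small ++ big) x <= L *+ m ->
  exists2 a : seq 'I_m, size a = size (small ++ big) &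
    forall i, load (zip a (small ++ big)) i <= L + e.
Proof.
move=> m0 L0 e0; elim: small => [_ bm bL _|x small IH] /=.
  have [a sa la] := separate_assignment _ _ L0 bm bL.
  by exists a => // i; rewrite ler_wpDr.
move=> /andP[/andP[x0 xe] smalle] bm bL; rewrite big_cons => tot.
have tot' : \sum_(y <- small ++ big) y <= L *+ m by apply: le_trans tot; rewrite lerDr.
have [a sa la] := IH smalle bm bL tot'.
have [i iL] : exists i, load (zip a (small ++ big)) i <= L.
  apply/existsP; apply: contraT; rewrite negb_exists => /forallP H.
  have : L *+ m < \sum_i load (zip a (small ++ big)) i.
    rewrite -[X in _ *+ X]card_ord -sumr_const; apply: ltr_sum.
      by apply/hasP; exists (Ordinal m0); rewrite ?mem_index_enum.
    by move=> i _; rewrite real_ltNge ?num_real.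
  rewrite sum_load -(big_map snd xpredT id) -/unzip2 unzip2_zip ?sa // => H'.
  by move: tot'; rewrite leNgt H'.
exists (i :: a); first by rewrite /= sa.
move=> k /=; rewrite load_cons /=; case: eqP => [<-|_]; last by rewrite add0r.
by rewrite addrC lerD.
Qed.

End Makespan.

(** * Averages over uniform coin words *)

Section CoinMean.
Context {R : realType}.
Implicit Types f g : seq bool -> R.

Fixpoint words (n : nat) : seq (seq bool) :=
  if n is n'.+1 then map (cons false) (words n') ++ map (cons true) (words n')
  else [:: [::]].

Definition mean (n : nat) f : R := (\sum_(bs <- words n) f bs) / 2 ^+ n.

Lemma sum_words n f : \sum_(bs <- words n) f bs = 2 ^+ n * mean n f.
Proof. by rewrite mulrC divfK // expf_neq0 // pnatr_eq0. Qed.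

Lemma size_words n bs : bs \in words n -> size bs = n.
Proof.
elim: n bs => [|n IH] bs /=; first by rewrite inE => /eqP->.
by rewrite mem_cat => /orP[] /mapP[cs /IH <- ->].
Qed.

Lemma mean0 f : mean 0 f = f [::].
Proof. by rewrite /mean big_seq1 divr1. Qed.

Lemma meanS n f : mean n.+1 f =
  (mean n (fun bs => f (false :: bs)) + mean n (fun bs => f (true :: bs))) / 2.
Proof. by rewrite /mean big_cat !big_map exprSr invfM mulrA mulrDl. Qed.

Lemma eq_mean n f g : f =1 g -> mean n f = mean n g.
Proof. by move=> fg; congr (_ / _); apply: eq_bigr. Qed.

Lemma le_mean n f g : (forall bs, size bs = n -> f bs <= g bs) -> mean n f <= mean n g.
Proof.
move=> fg; rewrite ler_wpM2r ?invr_ge0 ?exprn_ge0 //.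
by rewrite big_seq [leRHS]big_seq; apply: ler_sum => bs /size_words /fg.
Qed.

Lemma meanD n f g : mean n (fun bs => f bs + g bs) = mean n f + mean n g.
Proof. by rewrite /mean big_split mulrDl. Qed.

Lemma meanZ n f (c : R) : mean n (fun bs => c * f bs) = c * mean n f.
Proof. by rewrite /mean -mulr_sumr mulrA. Qed.

Lemma mean_const n (c : R) : mean n (fun=> c) = c.
Proof. by elim: n => [|n IH]; rewrite ?mean0 // meanS IH mulrDl -splitr. Qed.

Lemma mean_sum n k (F : 'I_k -> seq bool -> R) :
  mean n (fun bs => \sum_l F l bs) = \sum_l mean n (F l).
Proof. by rewrite /mean exchange_big -mulr_suml. Qed.

End CoinMean.

(** * Coin jobs, the random input and its offline optimum *)

Section Adversary.
Context {R : realType}.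
Implicit Types (t S : R) (ts : seq (R -> R)) (I : instance R) (bs : seq bool).

Lemma coin_ptime_ge0 t (b : bool) : 0 <= (if b then 2 * `|t| else 0).
Proof. by case: b; rewrite ?mulr_ge0. Qed.

Lemma coin_ptime_le t (b : bool) : (if b then 2 * `|t| else 0) <= 2 * `|t|.
Proof. by case: b; rewrite ?mulr_ge0. Qed.

(* The absolute value makes this a job for every [t]; only [t >= 0] is ever used. *)
Definition coin_job t (b : bool) : job R :=
  Job (normr_ge0 t) (coin_ptime_ge0 t b) (coin_ptime_le t b).

Lemma offline_coin_job t b : offline_time (coin_job t b) = (1 + b%:R) * `|t|.
Proof.
have t0 := normr_ge0 t.
rewrite /offline_time; case: b => /=.
  by rewrite min_l //; lra.
by rewrite min_r; lra.
Qed.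

Lemma offline_time_ge0 (j : job R) : 0 <= offline_time j.
Proof.
rewrite /offline_time le_min (le_trans (ptime_ge0 j) (ptime_le j)).
by rewrite addr_ge0 ?ttime_ge0 ?ptime_ge0.
Qed.

Definition total_time I : R := \sum_(j <- I) offline_time j.

Lemma total_cons (j : job R) I : total_time (j :: I) = offline_time j + total_time I.
Proof. exact: big_cons. Qed.

Lemma total_nil : total_time [::] = 0.
Proof. exact: big_nil. Qed.

Lemma total_ge0 I : 0 <= total_time I.
Proof. by apply: sumr_ge0 => j _; apply: offline_time_ge0. Qed.

(* [S] is the total offline time of the previous jobs; the testing time of the
   next job depends on it through the head of [ts]. *)
Fixpoint adversary ts S bs : instance R :=
  match ts, bs with
  | t :: ts', b :: bs' =>
      let j := coin_job (t S) b in j :: adversary ts' (S + offline_time j) bs'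
  | _, _ => [::]
  end.

Lemma adversary_cat ts1 ts2 S bs : adversary (ts1 ++ ts2) S bs =
  adversary ts1 S bs ++
  adversary ts2 (S + total_time (adversary ts1 S bs)) (drop (size ts1) bs).
Proof.
elim: ts1 S bs => [|t ts IH] S [|b bs] /=; rewrite ?total_nil ?addr0 //.
  by case: (ts2).
by rewrite IH total_cons addrA.
Qed.

Lemma size_adversary ts S bs : size (adversary ts S bs) = minn (size ts) (size bs).
Proof. by elim: ts S bs => [|t ts IH] S [|b bs] //=; rewrite IH minnSS. Qed.

(** The decision precedes the coin, so it is the same in both branches: untested the job takes
    [2 t], tested it takes [t] or [3 t]. The later history and total depend on the coin, hence the
    induction over all [h] and [S]. *)
Lemma mean_total_len (m : nat) (A : online_algorithm R m) h ts S :
  mean (size ts) (fun bs => \sum_(x <- schedule_from A h (adversary ts S bs)) x.2) =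
  4 / 3 * mean (size ts) (fun bs => total_time (adversary ts S bs)).
Proof.
elim: ts h S => [|t ts IH] h S; first by rewrite !mean0 /= total_nil big_nil mulr0.
rewrite !meanS /=.
under eq_mean do rewrite big_cons /=.
under [X in _ + X]eq_mean do rewrite big_cons /=.
under [in RHS]eq_mean do rewrite total_cons.
under [X in _ = _ * ((_ + X) / _)]eq_mean do rewrite total_cons.
rewrite -/(size ts) !meanD !mean_const !IH !offline_coin_job /=.
by case: (tested _); lra.
Qed.

(** An online algorithm cannot foresee where the input stops. *)
Lemma schedule_take (m : nat) (A : online_algorithm R m) h k I :
  schedule_from A h (take k I) = take k (schedule_from A h I).
Proof. by elim: I k h => [|j I IH] [|k] h //=; rewrite IH. Qed.

Lemma size_schedule (m : nat) (A : online_algorithm R m) h I :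
  size (schedule_from A h I) = size I.
Proof. by elim: I h => //= j I IH h; rewrite IH. Qed.

Lemma opt_makespan_ge0 (m : nat) I : (0 < m)%N -> 0 <= opt_makespan m I.
Proof.
move=> m0; apply: lb_le_inf.
  by exists (makespan (zip (nseq_tuple (size I) (Ordinal m0)) (map (@offline_time R) I))),
    (nseq_tuple (size I) (Ordinal m0)).
by move=> _ [a _ <-]; apply: makespan_ge0.
Qed.

Lemma opt_makespan_le (m : nat) I (L : R) (a : seq 'I_m) : 0 <= L -> size a = size I ->
  (forall i, load (zip a (map (@offline_time R) I)) i <= L) -> opt_makespan m I <= L.
Proof.
move=> L0 /eqP sa la; apply: le_trans (makespan_le _ _ L0 la).
apply: ge_inf; last by exists (Tuple sa).
by exists 0 => _ [b _ <-]; apply: makespan_ge0.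
Qed.

Lemma opt_makespan_greedy (m : nat) I1 I2 (e : R) : (0 < m)%N -> 0 <= e ->
  (forall j, List.In j I1 -> offline_time j <= e) ->
  (size I2 <= m)%N -> (forall j, List.In j I2 -> offline_time j <= total_time (I1 ++ I2) / m%:R) ->
  opt_makespan m (I1 ++ I2) <= total_time (I1 ++ I2) / m%:R + e.
Proof.
move=> m0 e0 H1 sz H2; set L := _ / _ in H2 *.
have L0 : 0 <= L by rewrite divr_ge0 ?total_ge0.
have allP (P : pred R) I : (forall j, List.In j I -> P (offline_time j)) ->
    all P (map (@offline_time R) I).
  elim: I => //= j I IH H; rewrite H; last by left.
  by apply: IH => k kI; apply: H; right.
have small : all (fun x => 0 <= x <= e) (map (@offline_time R) I1).
  by apply: allP => j /H1 ->; rewrite offline_time_ge0.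
have := greedy_assignment _ (map (@offline_time R) I2) _ _ m0 L0 e0 small.
rewrite size_map -map_cat => /(_ sz).
case; first exact: allP.
  by rewrite big_map -/(total_time _) -(mulr_natr L) divfK // pnatr_eq0 -lt0n.
move=> a; rewrite size_map => sa la.
by apply: opt_makespan_le sa la; rewrite addr_ge0.
Qed.

End Adversary.

(** * Yao's principle *)

Section Yao.
Context {R : realType} {m : nat}.

Lemma expected_makespanE (A : randomized_algorithm R m) (I : instance R) :
  expected_makespan A I =
  (\int[ra_prob A]_w (alg_makespan (ra_alg w) I)%:E)%E.
Proof. by rewrite /expected_makespan unlock. Qed.

Lemma expected_makespan_le (A : randomized_algorithm R m) (I : instance R) (c : R) :
  (0 < m)%N -> (expected_competitive_ratio A <= c%:E)%E ->
  (expected_makespan A I <= (c * opt_makespan m I)%:E)%E.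
Proof.
move=> m0 ratio_c.
have : (expected_makespan A I / (opt_makespan m I)%:E <= c%:E)%E.
  by apply: le_trans ratio_c; apply: ereal_sup_ubound; exists I.
(* If the optimum is 0, its inverse is [+oo], so a finite ratio forces the expected makespan to be
   0. *)
have := opt_makespan_ge0 m I m0; rewrite le_eqVlt => /orP[/eqP<-|opt_gt0].
  have : (0 <= expected_makespan A I)%E.
    rewrite expected_makespanE; apply: integral_ge0 => w _.
    by rewrite lee_fin makespan_ge0.
  rewrite inver eqxx mulr0 le_eqVlt => /orP[/eqP<-//|e0].
  by rewrite gt0_muley.
by rewrite inver gt_eqF // lee_pdivrMr // EFinM.
Qed.

(** Integrating the deterministic bound over the random algorithm keeps [K], while a ratio below [c]
    would give less than [K]. The list [Is] acts as a uniform distribution, with multiplicity. *)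
Lemma yao (A : randomized_algorithm R m) (Is : seq (instance R)) (c K : R) :
  (0 < m)%N -> 0 <= K -> c * \sum_(I <- Is) opt_makespan m I < K ->
  (forall B : online_algorithm R m, K <= \sum_(I <- Is) alg_makespan B I) ->
  (c%:E <= expected_competitive_ratio A)%E.
Proof.
move=> m0 K0 optK det; rewrite leNgt; apply/negP => /ltW ratio_c.
suff : (K%:E <= (c * \sum_(I <- Is) opt_makespan m I)%:E)%E by rewrite lee_fin leNgt optK.
rewrite mulr_sumr -sumEFin.
apply: (@le_trans _ _ (\sum_(I <- Is) expected_makespan A I)%E); last first.
  by apply: lee_sum => I _; apply: expected_makespan_le.
rewrite (eq_bigr _ (fun I _ => expected_makespanE A I)).
rewrite -ge0_integral_sum //; last 2 first.
- by move=> I; apply/measurable_EFinP; apply: ra_measurable.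
- by move=> I w _; rewrite lee_fin makespan_ge0.
rewrite -[leLHS]mule1 -(probability_setT (ra_prob A)) -integral_cst //.
apply: ge0_le_integral => //.
- by apply: emeasurable_sum => I; apply/measurable_EFinP; apply: ra_measurable.
- by move=> w _; rewrite sumEFin lee_fin.
Qed.

End Yao.

(** * The input of small and big jobs *)

Section Chain.
Context {R : realType} (m : nat).
Context (m_gt1 : (1 < m)%N).
Implicit Types (S : R) (bs : seq bool).

Let M_gt1 : 1 < m%:R :> R.
Proof. by rewrite ltr1n. Qed.

(** A constant function of the total, so that small and big jobs share one list for [adversary]. *)
Definition sand_time (S : R) : R := 1.

Definition big_time (S : R) : R := S / (2 * (m%:R - 1)).

(* The mean growth factor of the total offline time over a big job. *)
Definition growth : R := 1 + 3 / (4 * (m%:R - 1)).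

(** [big_time] is linear in [S], so the first coin turns [S] into a total of mean [growth * S], and
    the induction applies to both outcomes. *)
Lemma mean_total_big n j S : 0 <= S -> (j <= n)%N ->
  mean n (fun bs => S + total_time (take j (adversary (nseq n big_time) S bs))) = growth ^+ j * S.
Proof.
elim: n j S => [|n IH] [|j] S S0 jn //.
- by rewrite mean0 /= total_nil addr0 mul1r.
- by under eq_mean do rewrite take0 total_nil; rewrite mean_const addr0 mul1r.
have b0 : 0 <= big_time S by rewrite divr_ge0 // mulr_ge0 // subr_ge0 ltW.
rewrite meanS /=.
under eq_mean do rewrite total_cons addrA.
under [X in _ + X]eq_mean do rewrite total_cons addrA.
rewrite !IH ?addr_ge0 ?offline_time_ge0 // !offline_coin_job ger0_norm //= exprSr.
by rewrite /big_time /growth; field; rewrite subr_eq0 gt_eqF.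
Qed.

Lemma mean_total N n j S : 0 <= S -> (j <= n)%N ->
  mean (N + n)
    (fun bs => S + total_time (take (N + j) (adversary (nseq N sand_time ++ nseq n big_time) S bs))) =
  growth ^+ j * (S + 3 / 2 * N%:R).
Proof.
move=> + jn; elim: N S => [|N IH] S S0.
  by rewrite mulr0 addr0 mean_total_big.
rewrite !addSn meanS /=.
under eq_mean do rewrite total_cons addrA.
under [X in _ + X]eq_mean do rewrite total_cons addrA.
rewrite !IH ?addr_ge0 ?offline_time_ge0 // !offline_coin_job normr1 /= -[N.+1]addn1 natrD.
by field.
Qed.

Lemma sand_le2 N S bs j : List.In j (adversary (nseq N sand_time) S bs) -> offline_time j <= 2.
Proof.
elim: N S bs => [|N IH] S [|b bs] //= [<-|/IH //].
by rewrite offline_coin_job normr1; case: b => /=; lra.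
Qed.

(* A big job of maximal length [S / (m - 1)] brings the total to exactly [m] times
   its length. *)
Lemma big_le_average n k S bs j : 0 <= S ->
  List.In j (take k (adversary (nseq n big_time) S bs)) ->
  offline_time j <= (S + total_time (take k (adversary (nseq n big_time) S bs))) / m%:R.
Proof.
elim: n k S bs => [|n IH] [|k] S [|b bs] //= S0.
set x := coin_job _ b; rewrite total_cons addrA.
move=> [<-|jin]; last by apply: IH jin; rewrite addr_ge0 // offline_time_ge0.
rewrite ler_pdivlMr; last by rewrite (lt_trans ltr01).
apply: (@le_trans _ _ (S + offline_time x)); last by rewrite lerDl total_ge0.
have d0 : 0 < m%:R - 1 :> R by rewrite subr_gt0.
have b0 : 0 <= big_time S by rewrite divr_ge0 // mulr_ge0 // ltW.
have bS : S = 2 * big_time S * (m%:R - 1) by rewrite /big_time; field; rewrite gt_eqF.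
have M2 : 2 <= m%:R :> R by rewrite ler_nat.
rewrite offline_coin_job ger0_norm // {2}bS; case: (b) => /=; nra.
Qed.

Definition chain N bs : instance R :=
  adversary (nseq N sand_time ++ nseq m big_time) 0 bs.

Lemma opt_makespan_prefix N k bs : (k <= m)%N -> size bs = (N + m)%N ->
  opt_makespan m (take (N + k) (chain N bs)) <=
  total_time (take (N + k) (chain N bs)) / m%:R + 2.
Proof.
move=> km sbs.
set I1 := adversary (nseq N sand_time) 0 bs.
pose I2 := take k (adversary (nseq m big_time) (total_time I1) (drop N bs)).
have sI1 : size I1 = N.
  by rewrite size_adversary size_nseq sbs; apply/minn_idPl/leq_addr.
have -> : take (N + k) (chain N bs) = I1 ++ I2.
  rewrite /chain adversary_cat size_nseq add0r take_cat -/I1 sI1.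
  by rewrite ltnNge leq_addr /= addKn.
apply: opt_makespan_greedy => //.
- exact: ltnW.
- by move=> j; apply: sand_le2.
- by rewrite size_take_min (leq_trans (geq_minl _ _)).
move=> j /big_le_average; rewrite /total_time big_cat; apply; exact: total_ge0.
Qed.

End Chain.

(** * Estimates for powers of the growth factor *)

Section Growth.
Context {R : realType}.

(** Second-order binomial truncation; each step discards the term [k (k - 1) / 2 * q ^+ 3]. *)
Lemma exprB1_le (q : R) k : 0 <= q <= 1 ->
  (1 - q) ^+ k <= 1 - k%:R * q + k%:R * (k%:R - 1) / 2 * q ^+ 2.
Proof.
move=> /andP[q0 q1]; elim: k => [|k IH]; first by rewrite expr0; lra.
rewrite exprS (le_trans (ler_wpM2l _ IH)) ?subr_ge0 //.
have kk : 0 <= k%:R * (k%:R - 1) / 2 * q ^+ 3 :> R.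
  rewrite mulr_ge0 ?exprn_ge0 // divr_ge0 //.
  by case: k {IH} => [|k]; rewrite ?mul0r // mulr_ge0 // subr_ge0 ler1n.
by rewrite -[k.+1]addn1 natrD; lra.
Qed.

Lemma sum_exprB1_le (q : R) n : 0 <= q <= 1 ->
  \sum_(k < n) (1 - q) ^+ k <=
  n%:R - n%:R * (n%:R - 1) / 2 * q + n%:R * (n%:R - 1) * (n%:R - 2) / 6 * q ^+ 2.
Proof.
move=> q01; elim: n => [|n IH]; first by rewrite big_ord0; lra.
rewrite big_ord_recr /= (le_trans (lerD IH (exprB1_le q n q01))) //.
by rewrite -[n.+1]addn1 natrD; lra.
Qed.

(** The constant 16/21 is 4/3 divided by the target ratio 7/4. Dividing by [growth m ^+ m] leaves a
    sum of powers of [1 - q]. *)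
Lemma sum_growth_le (m : nat) : (3 <= m)%N ->
  \sum_(k < m) growth m ^+ (m - k) <= 16 / 21 * m%:R * growth m ^+ m :> R.
Proof.
move=> m3; have M3 : 3 <= m%:R :> R by rewrite ler_nat.
pose q : R := 3 / (4 * m%:R - 1).
have D0 : 0 < 4 * m%:R - 1 :> R by lra.
have qD : q * (4 * m%:R - 1) = 3 by rewrite divfK // gt_eqF.
have q01 : 0 <= q <= 1 by rewrite divr_ge0 ?ler_pdivrMr //; lra.
have gE : (@growth R m)^-1 = 1 - q.
  rewrite /growth /q; field; rewrite !gt_eqF //; lra.
have g0 : 0 < @growth R m.
  by rewrite -invr_gt0 gE subr_gt0 ltr_pdivrMr //; lra.
under eq_bigr => k _.
  rewrite expfB_cond; last by rewrite gt_eqF // add0n ltnW.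
  rewrite -exprVn gE; over.
rewrite -mulr_sumr mulrC ler_pM2r ?exprn_gt0 // (le_trans (sum_exprB1_le _ m q01)) //.
suff : 0 <= m%:R * (16 / 21 - 1 + (m%:R - 1) / 2 * q - (m%:R - 1) * (m%:R - 2) / 6 * q ^+ 2) by lra.
(* Multiplying by [(4 * m%:R - 1) ^+ 2] replaces [q] by the constant 3 and leaves a quadratic in
   [m], positive from 3 on. *)
rewrite mulr_ge0 // -(pmulr_lge0 _ (exprn_gt0 2 D0)).
rewrite [X in 0 <= X](_ : _ = (16 / 21 - 1) * (4 * m%:R - 1) ^+ 2
   + (m%:R - 1) / 2 * (q * (4 * m%:R - 1)) * (4 * m%:R - 1)
   - (m%:R - 1) * (m%:R - 2) / 6 * (q * (4 * m%:R - 1)) ^+ 2); last by ring.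
rewrite qD; clear q qD q01 gE; have := sqr_ge0 (m%:R - 3 : R); lra.
Qed.

End Growth.

(** * The hard distribution and the numerical comparison *)

Theorem theorem4 (R : realType) (m : nat) (hm : (3 <= m)%N)
    (A : randomized_algorithm R m) :
  ((21 / 2 - Num.sqrt 78 : R)%:E <= expected_competitive_ratio A)%E.
Proof.
have m_gt1 : (1 < m)%N by apply: ltnW.
have m0 : (0 < m)%N by apply: ltnW.
have M0 : 0 < m%:R :> R by rewrite ltr0n.
apply: (@le_trans _ _ (167 / 100 : R)%:E).
  (* 8.83 squared is 77.9689, and 10.5 - 8.83 = 1.67. *)
  have s78 : 883 / 100 <= Num.sqrt 78 :> R.
    have sq : Num.sqrt 78 ^+ 2 = 78 :> R by apply: sqr_sqrtr; lra.
    by rewrite leNgt; apply/negP => ?; have := sqrtr_ge0 (78 : R); nra.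
  by rewrite lee_fin; lra.
(* Small jobs then total [60 m] on average, enough to absorb the additive 2: 1.67 (60 * 16/21 + 2) <
   80 = 4/3 * 60. *)
pose N := (40 * m)%N.
pose Is : seq (instance R) := [seq take (N + (m - k)) (chain m N bs)
          | bs : seq bool <- words (N + m), k : 'I_m <- index_enum 'I_m].
have sumIs (F : instance R -> R) : \sum_(I <- Is) F I = 2 ^+ (N + m) *
    mean (N + m) (fun bs => \sum_(k < m) F (take (N + (m - k)) (chain m N bs))).
  by rewrite -sum_words /Is big_allpairs_dep.
have mean_chain j : (j <= m)%N ->
    mean (N + m) (fun bs => total_time (take (N + j) (chain m N bs))) =
    growth m ^+ j * (60 * m%:R) :> R.
  move=> jm; have := mean_total m m_gt1 N m j (0 : R) (lexx _) jm.
  rewrite (_ : 0 + 3 / 2 * N%:R = 60 * m%:R); last by rewrite /N natrM; field.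
  by move=> <-; apply: eq_mean => bs; rewrite add0r.
have sizeN bs : size bs = (N + m)%N -> size (chain m N bs : instance R) = (N + m)%N.
  by move=> sbs; rewrite size_adversary size_cat !size_nseq sbs minnn.
pose K : R := 2 ^+ (N + m) * (4 / 3 * (growth m ^+ m * (60 * m%:R))).
have g1 : 1 <= @growth R m.
  by rewrite lerDl divr_ge0 // mulr_ge0 // subr_ge0 ler1n.
have G1 : 1 <= @growth R m ^+ m by apply: exprn_ege1.
apply: (@yao _ _ _ Is _ K) => //.
- by rewrite !mulr_ge0 // ?exprn_ge0 // (le_trans ler01).
- rewrite sumIs /K mulrCA ltr_pM2l ?exprn_gt0 //.
  apply: (@le_lt_trans _ _ (167 / 100 * (60 * (16 / 21 * m%:R * growth m ^+ m) + 2 * m%:R))); last first.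
    have : m%:R <= m%:R * growth m ^+ m :> R by rewrite ler_pMr.
    by lra.
  rewrite ler_pM2l; last by lra.
  apply: (@le_trans _ _ (\sum_(k < m) (60 * growth m ^+ (m - k) + 2))); last first.
    rewrite big_split /= -mulr_sumr sumr_const card_ord -[2 *+ m]mulr_natr.
    by rewrite lerD2r ler_pM2l // sum_growth_le.
  rewrite mean_sum; apply: ler_sum => k _.
  have -> : 60 * growth m ^+ (m - k) =
      mean (N + m) (fun bs => m%:R^-1 * total_time (take (N + (m - k)) (chain m N bs))) :> R.
    by rewrite meanZ mean_chain ?leq_subr //; field; rewrite gt_eqF.
  rewrite -[in leRHS](mean_const (N + m) 2) -meanD.
  apply: le_mean => bs sbs; rewrite [_^-1 * _]mulrC.
  by apply: opt_makespan_prefix => //; apply: leq_subr.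
(* For each coin word the [m] prefix makespans cover the full load, whose mean is 4/3 of the mean
   offline total. *)
move=> B; rewrite sumIs /K ler_pM2l ?exprn_gt0 // -mean_chain //.
have full bs : total_time (take (N + m) (chain m N bs)) = total_time (chain m N bs) :> R.
  by rewrite take_oversize // size_adversary size_cat !size_nseq geq_minl.
rewrite (eq_mean _ _ _ full).
have := mean_total_len m B [::] (nseq N sand_time ++ nseq m (big_time m)) 0.
rewrite size_cat !size_nseq => <-; apply: le_mean => bs sbs.
apply: le_trans (total_load_le_prefixes _) _.
rewrite size_schedule sizeN //; apply: ler_sum => k _.
by rewrite -schedule_take addnBA // ltnW.
Qed.
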